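(* Let $\mathcal A$ be a commutative unital C*-algebra and let $\mathcal M$ be a full Hilbert $\mathcal A$-module. Then each derivation $d$ on $\mathrm{End}_{\mathcal A}(\mathcal M)$ is $\mathcal A$-linear, i.e. $d(aA)=a\,d(A)$ for each $a\in\mathcal A$ and $A\in\mathrm{End}_{\mathcal A}(\mathcal M)$.
   Context: C*-algebras are complex. A Hilbert $\mathcal A$-module is a left $\mathcal A$-module $\mathcal M$ with an $\mathcal A$-valued inner product $\langle\cdot,\cdot\rangle:\mathcal M\times\mathcal M\to\mathcal A$ satisfying, for $\lambda\in\mathbb C$, $a\in\mathcal A$, $x,y,z\in\mathcal M$: $\langle x,x\rangle\ge 0$, and $\langle x,x\rangle=0$ implies $x=0$; $\langle\lambda x+y,z\rangle=\lambda\langle x,z\rangle+\langle y,z\rangle$; $\langle ax,y\rangle=a\langle x,y\rangle$; $\langle x,y\rangle=\langle y,x\rangle^*$; and such that $\mathcal M$ is complete for the norm $\|x\|=\|\langle x,x\rangle\|^{1/2}$. $\mathcal M$ is full if the closed linear span of $\{\langle x,y\rangle:x,y\in\mathcal M\}$ equals $\mathcal A$. A linear map $T:\mathcal M\to\mathcal M$ is $\mathcal A$-linear if $T(ax)=aT(x)$ for all $a\in\mathcal A$, $x\in\mathcal M$. $\mathrm{End}_{\mathcal A}(\mathcal M)$ is the Banach algebra (operator norm, composition) of all bounded $\mathcal A$-linear maps $\mathcal M\to\mathcal M$. Since $\mathcal A$ is commutative, for $a\in\mathcal A$ and $A\in\mathrm{End}_{\mathcal A}(\mathcal M)$ the map $aA$,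 defined by $(aA)x=a(Ax)$, lies in $\mathrm{End}_{\mathcal A}(\mathcal M)$. A derivation on an algebra $\mathcal B$ is a ($\mathbb C$-)linear map $d:\mathcal B\to\mathcal B$ with $d(xy)=d(x)y+xd(y)$ for all $x,y\in\mathcal B$ (no continuity assumed). *)

(* Defs.v *)
From HB Require Import structures.
From mathcomp Require Import all_boot all_order all_algebra.
From mathcomp Require Import all_classical all_reals all_analysis.
From mathcomp Require Export complex.

Set Implicit Arguments.
Unset Strict Implicit.
Unset Printing Implicit Defensive.

Import Order.TTheory GRing.Theory Num.Theory.
Import numFieldNormedType.Exports.

Local Open Scope classical_set_scope.
Local Open Scope ring_scope.

(* Unital C*-algebras. The multiplication is part of the mixin because the
   library has no structure of algebra over a ring that may be the zero ring
   ([algType] requires 1 != 0). The ring instances below give access to the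
   usual notations. *)
HB.mixin Record isCStarAlgebra (R : realType) A
    of CompleteNormedModule R[i] A := {
  cmul : A -> A -> A;
  cone : A;
  cmulA : associative cmul;
  cmul1r : left_id cone cmul;
  cmulr1 : right_id cone cmul;
  cmulDl : left_distributive cmul +%R;
  cmulDr : right_distributive cmul +%R;
  cmulZl : forall (k : R[i]) (a b : A), cmul (k *: a) b = k *: cmul a b;
  cmulZr : forall (k : R[i]) (a b : A), cmul a (k *: b) = k *: cmul a b;
  cstar_normM : forall a b : A, `|cmul a b| <= `|a| * `|b|;
  star : A -> A;
  starK : involutive star;
  starM : forall a b : A, star (cmul a b) = cmul (star b) (star a);
  star_antilinear : forall (k : R[i]) (a b : A),
    star (k *: a + b) = Num.conj k *: star a + star b;
  cstar_identity : forall a : A, `|cmul (star a) a| = `|a| ^+ 2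
}.

#[short(type="cstarAlgType")]
HB.structure Definition CStarAlgebra (R : realType) :=
  {A of CompleteNormedModule R[i] A & isCStarAlgebra R A}.

#[non_forgetful_inheritance]
HB.instance Definition _ (R : realType) (A : cstarAlgType R) :=
  GRing.Zmodule_isPzRing.Build (CStarAlgebra.sort A)
    (@cmulA R A) (@cmul1r R A) (@cmulr1 R A) (@cmulDl R A) (@cmulDr R A).

HB.mixin Record CStarAlgebra_isCommutative (R : realType) A
    of CStarAlgebra R A := {
  cmulC : commutative (@cmul R A)
}.

#[short(type="comCStarAlgType")]
HB.structure Definition ComCStarAlgebra (R : realType) :=
  {A of CStarAlgebra R A & CStarAlgebra_isCommutative R A}.

#[non_forgetful_inheritance]
HB.instance Definition _ (R : realType) (A : comCStarAlgType R) :=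
  GRing.PzRing.copy (ComCStarAlgebra.sort A) (CStarAlgebra.sort A).
#[non_forgetful_inheritance]
HB.instance Definition _ (R : realType) (A : comCStarAlgType R) :=
  GRing.PzRing_hasCommutativeMul.Build (ComCStarAlgebra.sort A) (@cmulC R A).

Definition spectrum (R : realType) (A : cstarAlgType R) (a : A) : set R[i] :=
  [set l | let u : A := a - l *: (1 : A) in
     ~ exists b : A, u * b = 1 /\ b * u = 1].

(* The order of R[i] makes [0 <= l] say that l is real and nonnegative. *)
Definition cstar_nonneg (R : realType) (A : cstarAlgType R) (a : A) : Prop :=
  star a = a /\ forall l : R[i], spectrum a l -> 0 <= l.

(* Left Hilbert modules. The last axiom says that the ambient complete norm
   of M is the one induced by the inner product. *)
HB.mixin Record isHilbertModule (R : realType) (A : cstarAlgType R) M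
    of CompleteNormedModule R[i] M := {
  hact : A -> M -> M;
  hactDl : forall (a b : A) (x : M), hact (a + b) x = hact a x + hact b x;
  hactDr : forall (a : A) (x y : M), hact a (x + y) = hact a x + hact a y;
  hactA : forall (a b : A) (x : M), hact a (hact b x) = hact (a * b) x;
  hact1 : forall x : M, hact 1 x = x;
  hactZl : forall (k : R[i]) (a : A) (x : M), hact (k *: a) x = k *: hact a x;
  hactZr : forall (k : R[i]) (a : A) (x : M), hact a (k *: x) = k *: hact a x;
  inner : M -> M -> A;
  inner_nonneg : forall x : M, cstar_nonneg (inner x x);
  inner_eq0 : forall x : M, inner x x = 0 -> x = 0;
  inner_linear : forall (k : R[i]) (x y z : M),
    inner (k *: x + y) z = k *: inner x z + inner y z;
  inner_hact : forall (a : A) (x y : M), inner (hact a x) y = a * inner x y;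
  inner_star : forall x y : M, inner x y = star (inner y x);
  hnormE : forall x : M, `|x| = sqrtC `|inner x x|
}.

#[short(type="hilbertModType")]
HB.structure Definition HilbertModule (R : realType) (A : cstarAlgType R) :=
  {M of CompleteNormedModule R[i] M & isHilbertModule R A M}.

Definition linear_span (K : pzRingType) (V : lmodType K) (S : set V) : set V :=
  [set v | exists (n : nat) (c : 'I_n -> K) (s : 'I_n -> V),
     (forall i, S (s i)) /\ v = \sum_(i < n) c i *: s i].

Definition full_module (R : realType) (A : cstarAlgType R)
    (M : hilbertModType A) : Prop :=
  closure (linear_span [set a : A | exists x y : M, a = inner x y]) = [set: A].

Section BoundedAction.
Context (R : realType) (A : cstarAlgType R).

Lemma star_norm_le (a : A) : `|a| <= `|star a|.
Proof.
have [->|a0] := eqVneq a 0; first by rewrite normr0.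
have pa : 0 < `|a| by rewrite normr_gt0.
rewrite -(ler_pM2r pa) -expr2 -cstar_identity; exact: cstar_normM.
Qed.

Lemma norm_star (a : A) : `|star a| = `|a|.
Proof.
by apply/eqP; rewrite eq_le star_norm_le andbT -{2}[a]starK star_norm_le.
Qed.

Lemma norm_hact (M : hilbertModType A) (a : A) (x : M) :
  `|hact a x| <= `|a| * `|x|.
Proof.
have ge0 (y : M) : 0 <= sqrtC `|inner y y| by rewrite sqrtC_ge0.
rewrite !hnormE -(@ler_pXn2r _ 2) ?nnegrE ?mulr_ge0 ?ge0 //.
rewrite exprMn !sqrtCK inner_hact inner_star inner_hact.
apply: (le_trans (cstar_normM _ _)).
rewrite expr2 -mulrA ler_wpM2l // norm_star.
exact: cstar_normM.
Qed.

End BoundedAction.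

Section Endomorphisms.
Context (R : realType) (A : cstarAlgType R) (M : hilbertModType A).

Definition is_hend : {pred M -> M} := fun f =>
  `[< [/\ linear f,
          forall (a : A) (x : M), f (hact a x) = hact a (f x) &
          exists k : R[i], forall x : M, `|f x| <= k * `|x| ] >].

Record hend := Hend { hend_fun :> M -> M ; hendP : is_hend hend_fun }.

HB.instance Definition _ := [isSub for hend_fun].
HB.instance Definition _ := [Choice of hend by <:].

Lemma hend_linear (f : hend) : linear f.
Proof. by have /asboolP[] := hendP f. Qed.

Lemma hend_hact (f : hend) (a : A) (x : M) : f (hact a x) = hact a (f x).
Proof. by have /asboolP[] := hendP f. Qed.

Lemma hend_bounded (f : hend) :
  exists2 k : R[i], 0 <= k & forall x : M, `|f x| <= k * `|x|.
Proof.
have /asboolP[_ _ [k kf]] := hendP f; exists `|k| => // x.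
have h0 : 0 <= k * `|x| by exact: le_trans (kf x).
by rewrite -[`|x|]normr_id -normrM ger0_norm.
Qed.

Lemma hendD (f g : hend) (x y : M) : f (x + y) = f x + f y.
Proof. by have := hend_linear f 1 x y; rewrite !scale1r. Qed.

Lemma is_hend_submod : GRing.submod_closed is_hend.
Proof.
split.
  apply/asboolP; split.
  - by move=> k x y /=; rewrite scaler0 addr0.
  - by move=> a x /=; apply: (addrI (hact a 0)); rewrite -hactDr !addr0.
  - by exists 0 => x; rewrite normr0 mul0r.
move=> k f g fP gP.
have [kf kf0 fk] := hend_bounded (Hend fP).
have [kg kg0 gk] := hend_bounded (Hend gP).
have E (x : M) : (k *: f + g) x = k *: f x + g x by [].
have fL := hend_linear (Hend fP); have gL := hend_linear (Hend gP).
have fA := hend_hact (Hend fP); have gA := hend_hact (Hend gP).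
rewrite /= in fL gL fA gA.
apply/asboolP; split.
- move=> l x y; rewrite !E fL gL !scalerDr !scalerA [k * l]mulrC.
  by rewrite addrACA.
- by move=> a x; rewrite !E fA gA hactDr hactZr.
- exists (`|k| * kf + kg) => x; rewrite E.
  rewrite (le_trans (ler_normD _ _)) // normrZ mulrDl -mulrA lerD ?gk //.
  by rewrite ler_wpM2l //; exact: fk.
Qed.

HB.instance Definition _ :=
  GRing.isSubmodClosed.Build _ _ is_hend is_hend_submod.
HB.instance Definition _ := [SubChoice_isSubLmodule of hend by <:].

Lemma is_hend_id : is_hend id.
Proof. by apply/asboolP; split=> //; exists 1 => x; rewrite mul1r. Qed.

Lemma is_hend_comp (f g : hend) : is_hend (f \o g).
Proof.
have [kf kf0 fk] := hend_bounded f; have [kg kg0 gk] := hend_bounded g.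
apply/asboolP; split.
- by move=> l x y /=; rewrite !hend_linear.
- by move=> a x /=; rewrite !hend_hact.
- by exists (kf * kg) => x /=; rewrite (le_trans (fk _)) // -mulrA ler_wpM2l.
Qed.

Definition hend_id := Hend is_hend_id.
Definition hend_comp (f g : hend) := Hend (is_hend_comp f g).

Lemma hend_compA : associative hend_comp.
Proof. by move=> f g h; exact/val_inj. Qed.

Lemma hend_comp1f : left_id hend_id hend_comp.
Proof. by move=> f; exact/val_inj. Qed.

Lemma hend_compf1 : right_id hend_id hend_comp.
Proof. by move=> f; exact/val_inj. Qed.

Lemma hend_compDl : left_distributive hend_comp +%R.
Proof. by move=> f g h; exact/val_inj. Qed.

Lemma hend_compDr : right_distributive hend_comp +%R.
Proof. by move=> f g h; apply/val_inj/funext => x /=; rewrite hendD. Qed.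

HB.instance Definition _ := GRing.Zmodule_isPzRing.Build hend
  hend_compA hend_comp1f hend_compf1 hend_compDl hend_compDr.

Definition is_derivation (d : hend -> hend) : Prop :=
  linear d /\ forall S T : hend, d (S * T) = d S * T + S * d T.

End Endomorphisms.

Section Scaling.
Context (R : realType) (A : comCStarAlgType R) (M : hilbertModType A).

Lemma is_hend_scale (a : A) (T : hend M) : is_hend (fun x => hact a (T x)).
Proof.
have [k k0 Tk] := hend_bounded T.
apply/asboolP; split.
- by move=> l x y; rewrite hend_linear hactDr hactZr.
- by move=> b x; rewrite hend_hact !hactA mulrC.
- exists (`|a| * k) => x.
  by rewrite (le_trans (norm_hact _ _)) // -mulrA ler_wpM2l.
Qed.

Definition hend_scale (a : A) (T : hend M) : hend M := Hend (is_hend_scale a T).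

End Scaling.

(* Main.v *)
(* Since [aT = (aI)T], it suffices to show [d(aI) = 0]. As [aI] is central, so is
   [d(aI)], and fullness provides [x_i], [y_i] and [v] with
   [v * sum_i <x_i, y_i> = 1]; commuting with the operators [z |-> <z, y> x]
   forces a central operator [C] to be multiplication by
   [v * sum_i <C x_i, y_i>].  Hence [d(aI) = (D a) I] for a derivation [D] of
   [A], and we show that a derivation of a commutative C*-algebra vanishes.

   On C(K) this holds because, for real [a], [a - a(t)] is a difference of two
   squares of functions vanishing at [t], so [D a] vanishes at [t].  To avoid
   Gelfand theory, positive elements are defined as squares of self-adjoint
   elements and points are replaced by preorderings.  If [B = (D a)^* (D a)]
   has norm [2r > 0], then the set [Q] of the [p + q (B - r)] with [p, q >= 0]
   (the elements that are nonnegative where [B >= r]) does not contain [-1].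
   Writing [l - a] as a difference of two squares and differentiating gives
   [B <= K |l - a|], hence [(l - a)^2 - s \in Q] for some [s > 0], for every
   real [l].  This is absurd for [l = inf {t | t - a \in Q}]. *)
Require Import Defs.
From HB Require Import structures.
From mathcomp Require Import all_boot all_order all_algebra.
From mathcomp Require Import all_classical all_reals all_analysis.
From mathcomp Require Import ring lra.

Set Implicit Arguments.
Unset Strict Implicit.
Unset Printing Implicit Defensive.

Import Order.TTheory GRing.Theory Num.Theory.
Import numFieldNormedType.Exports.
Local Open Scope classical_set_scope.
Local Open Scope ring_scope.

(* The norm of a normed space over [R[i]] takes its values in [R[i]]; [nrm] is
   its real-valued version, to which [lra] and [nra] apply. *)
Definition nrm (R : realType) (V : normedModType R[i]) (x : V) : R :=
  complex.Re `|x|.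

(** * Real-valued norms, completeness and limits of error bounds *)

Section RealNorm.
Context (R : realType) (V : normedModType R[i]).
Implicit Types x y : V.

Lemma normE x : `|x| = ((nrm x)%:C)%C.
Proof. by rewrite RRe_real. Qed.

Lemma nrm_ge0 x : 0 <= nrm x.
Proof. by rewrite -ler0c -normE. Qed.

Lemma nrm_eq0 x : nrm x = 0 -> x = 0.
Proof. by move=> h; apply/eqP; rewrite -normr_eq0 normE h. Qed.

Lemma nrmD x y : nrm (x + y) <= nrm x + nrm y.
Proof. by rewrite -lecR rmorphD /= -!normE ler_normD. Qed.

Lemma nrmN x : nrm (- x) = nrm x.
Proof. by rewrite /nrm normrN. Qed.

Lemma nrmB x y : nrm (x - y) = nrm (y - x).
Proof. by rewrite /nrm distrC. Qed.

Lemma nrmZ (k : R[i]) x : nrm (k *: x) = complex.Re `|k| * nrm x.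
Proof.
by rewrite /nrm normrZ (normE x); case: `|k| => s t /=; rewrite mulr0 subr0.
Qed.

Lemma nrmZr (k : R) x : 0 <= k -> nrm (k%:C%C *: x) = k * nrm x.
Proof. by move=> k0; rewrite nrmZ ger0_norm // ler0c. Qed.

End RealNorm.

(** The increments telescope to [e n - e m <= e n], so [u] is Cauchy and the bound on its tail
    survives in the limit. *)
Lemma nrm_complete (R : realType) (V : completeNormedModType R[i])
    (u : nat -> V) (e : nat -> R) :
  (forall n, 0 <= e n) -> e n @[n --> \oo] --> 0 ->
  (forall n, nrm (u n.+1 - u n) <= e n - e n.+1) ->
  exists l, forall n, nrm (l - u n) <= e n.
Proof.
move=> e_ge0 e0 ue1.
have ue n m : (n <= m)%N -> nrm (u m - u n) <= e n.
  move=> /subnK <-; set k := (m - n)%N.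
  suff : nrm (u (k + n)%N - u n) <= e n - e (k + n)%N.
    by have := e_ge0 (k + n)%N; lra.
  elim: k => [|k IH]; first by rewrite !subrr /nrm normr0.
  have := nrmD (u (k.+1 + n)%N - u (k + n)%N) (u (k + n)%N - u n).
  by rewrite addrA subrK; have := ue1 (k + n)%N; rewrite addSn; lra.
have ltC (r : R[i]) x : 0 < r -> (`|x : V| < r) = (nrm x < complex.Re r).
  by move=> r0; rewrite -[r in LHS](RRe_real (gtr0_real r0)) normE ltcR.
have Re_gt0 (r : R[i]) : 0 < r -> 0 < complex.Re r.
  by move=> r0; rewrite -ltcR RRe_real // gtr0_real.
have cu : cvg (u @ \oo).
  apply/cauchy_cvgP/cauchy_exP => r r0.
  have /cvgrPdist_lt/(_ _ (Re_gt0 r r0))[n _ en] := e0.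
  exists (u n), n => // m /= nm; rewrite -ball_normE /ball_ /= ltC // nrmB.
  apply: le_lt_trans (ue _ _ nm) _; have := en n (leqnn n).
  by rewrite /= sub0r normrN; exact/le_lt_trans/ler_norm.
exists (lim (u @ \oo)) => n; apply/ler_addgt0Pl => r r0.
have rC0 : 0 < r%:C%C by rewrite ltcR.
have /cvgrPdist_lt/(_ _ rC0)[k _ uk] := cu.
have := uk (maxn k n) (leq_maxl _ _); rewrite /= ltC //= => ur.
have := ue n (maxn k n) (leq_maxr _ _).
have := nrmD (lim (u @ \oo) - u (maxn k n)) (u (maxn k n) - u n).
rewrite addrA subrK; lra.
Qed.

(** Meant for [r] the norm of a defect: an estimate by a multiple of a vanishing error then yields
    an equality. *)
Lemma le0_of_cvg0 (R : realType) (e : nat -> R) (K r : R) :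
  e n @[n --> \oo] --> 0 -> (forall n, r <= K * e n) -> r <= 0.
Proof.
move=> e0 re.
have Ke0 : K * e n @[n --> \oo] --> 0.
  by rewrite -[X in _ --> X](mulr0 K); apply: cvgMr.
have : r <= lim (K * e n @[n --> \oo]).
  by apply: limr_ge; [exact: cvgP Ke0|exact: nearW].
by rewrite (cvg_lim (@Rhausdorff R) Ke0).
Qed.

(** * Scalars, the involution and the Neumann series *)

Section ComCStar.
Context (R : realType) (A : comCStarAlgType R).
Implicit Types a b x y p q w : A.

(** Placing real scalars inside [A] through a ring morphism turns identities that involve them into
    ring identities. *)
Definition rho (r : R) : A := r%:C%C *: (1 : A).

Fact rho_is_zmod_morphism : zmod_morphism rho.
Proof. by move=> r s; rewrite /rho rmorphB scalerBl. Qed.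

Fact rho_is_monoid_morphism : monoid_morphism rho.
Proof.
split; first by rewrite /rho rmorph1 scale1r.
move=> r s; rewrite /rho rmorphM -scalerA.
by rewrite [RHS]cmulZl; congr (_ *: _); rewrite [RHS]cmul1r.
Qed.

HB.instance Definition _ := GRing.isZmodMorphism.Build R A rho
  rho_is_zmod_morphism.
HB.instance Definition _ := GRing.isMonoidMorphism.Build R A rho
  rho_is_monoid_morphism.

Lemma scale_rho (r : R) x : r%:C%C *: x = rho r * x.
Proof. by rewrite [RHS]cmulZl; congr (_ *: _); rewrite [RHS]cmul1r. Qed.

Lemma nrmM x y : nrm (x * y) <= nrm x * nrm y.
Proof. by rewrite -lecR rmorphM /= -!normE; exact: cstar_normM. Qed.

Lemma nrm_star x : nrm (star x) = nrm x.
Proof. by rewrite /nrm norm_star. Qed.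

Lemma nrm_starM x : nrm (star x * x) = nrm x ^+ 2.
Proof. by apply: (@complexI R); rewrite rmorphXn /= -!normE; exact: cstar_identity. Qed.

Lemma starD x y : star (x + y) = star x + star y.
Proof. by have := star_antilinear 1 x y; rewrite !scale1r rmorph1 scale1r. Qed.

Lemma star0 : star (0 : A) = 0.
Proof. by apply: (@addrI _ (star 0)); rewrite -starD !addr0. Qed.

Lemma starZ (k : R[i]) x : star (k *: x) = Num.conj k *: star x.
Proof. by have := star_antilinear k x 0; rewrite star0 !addr0. Qed.

Lemma starN x : star (- x) = - star x.
Proof. by rewrite -scaleN1r starZ rmorphN rmorph1 scaleN1r. Qed.

Lemma starB x y : star (x - y) = star x - star y.
Proof. by rewrite starD starN. Qed.

Lemma starMC x y : star (x * y) = star x * star y.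
Proof. by rewrite [LHS]starM [RHS]mulrC. Qed.

Lemma star1 : star (1 : A) = 1.
Proof. by rewrite -[LHS]mulr1 -[X in _ * X]starK -starMC mul1r starK. Qed.

Lemma star_rho r : star (rho r) = rho r.
Proof. by rewrite starZ star1; congr (_ *: _); rewrite conj_Creal // complex_real. Qed.

(** The zero algebra is allowed, and there the norm of [1] is 0; hence only an inequality. *)
Lemma nrm1_le1 : nrm (1 : A) <= 1.
Proof.
have := nrm_starM 1; rewrite star1 mulr1 => h; have := nrm_ge0 (1 : A); nra.
Qed.

Lemma nrm_rho r : 0 <= r -> nrm (rho r) <= r.
Proof. by move=> r0; rewrite nrmZr //; have := nrm1_le1; nra. Qed.

Lemma neumann x r : nrm x <= r -> r < 1 -> exists y, (1 - x) * y = 1.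
Proof.
move=> xr r1; have x0 := nrm_ge0 x.
(* [u n] is the sum of [x ^+ i] for [i < n] in Horner form, and [e n] is the sum of [r ^+ i] for
   [i >= n]. *)
pose u := fix u n : A := if n is m.+1 then 1 + x * u m else 0.
pose e n := (1 - r)^-1 * r ^+ n.
have i0 : 0 < (1 - r)^-1 by rewrite invr_gt0; lra.
have e_ge0 n : 0 <= e n by apply: mulr_ge0; [lra|apply: exprn_ge0; lra].
have eE n : e n - e n.+1 = r ^+ n.
  by rewrite /e exprS; field; lra.
have e0 : e n @[n --> \oo] --> 0.
  rewrite -[X in _ --> X](mulr0 (1 - r)^-1); apply: cvgMr.
  by apply: cvg_expr; rewrite ger0_norm; lra.
have ue n : nrm (u n.+1 - u n) <= e n - e n.+1.
  rewrite eE; elim: n => [|n IH]; first by rewrite /= mulr0 addr0 subr0 nrm1_le1.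
  have -> : u n.+2 - u n.+1 = x * (u n.+1 - u n) by rewrite /=; ring.
  have := nrmM x (u n.+1 - u n); have := nrm_ge0 (u n.+1 - u n).
  have : 0 <= r ^+ n by apply: exprn_ge0; lra.
  rewrite exprS; nra.
have [l lu] := nrm_complete e_ge0 e0 ue; exists l.
apply/eqP; rewrite -subr_eq0; apply/eqP/nrm_eq0/eqP.
(* As [u n.+1 = 1 + x * u n], the defect is at most [e n.+1 + r * e n <= 2 * e n]. *)
rewrite eq_le nrm_ge0 andbT; apply: (le0_of_cvg0 (K := 2) e0) => n.
have -> : (1 - x) * l - 1 = (l - u n.+1) - x * (l - u n) by rewrite /=; ring.
have := nrmD (l - u n.+1) (- (x * (l - u n))); rewrite nrmN.
have := nrmM x (l - u n); have := lu n; have := lu n.+1.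
have : 0 <= r ^+ n by apply: exprn_ge0; lra.
have := eE n; have := nrm_ge0 (l - u n); nra.
Qed.

End ComCStar.

Arguments rho {R A} r.

(** * Square roots of [1 - x] by a dominated iteration *)

Section SqrtMajorant.
Context (R : realType).

(* The scalar iteration dominating y_{n+1} = (x + y_n^2) / 2, whose fixed
   point is 1 - sqrt (1 - x). *)
Fixpoint sqrt_maj n : R := if n is m.+1 then (1 + sqrt_maj m ^+ 2) / 2 else 0.

Lemma sqrt_maj_ge0 n : 0 <= sqrt_maj n.
Proof. by elim: n => //= n IH; nra. Qed.

Lemma sqrt_maj_le1 n : 0 <= 1 - sqrt_maj n.
Proof. by elim: n => [|n IH] /=; [|have := sqrt_maj_ge0 n]; nra. Qed.

Lemma sqrt_maj_cvg : 1 - sqrt_maj n @[n --> \oo] --> 0.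
Proof.
have h n : 1 - sqrt_maj n <= 2 * (n%:R + 2)^-1.
  elim: n => [|n IH]; first by rewrite /= subr0 add0r divff.
  rewrite [sqrt_maj n.+1]/= -[n.+1%:R]natr1; have n0 : 0 <= n%:R :> R by [].
  set t := sqrt_maj n in IH *; have := sqrt_maj_le1 n; rewrite -/t => t1.
  set k : R := n%:R in IH n0 *.
  (* One iteration sends [1 - t] to its image under [z - z ^+ 2 / 2], which increases for [z <= 1];
     so it is enough to evaluate it at the bound [s]. *)
  pose s := 2 * (k + 2)^-1.
  have i0 : 0 < (k + 2)^-1 by rewrite invr_gt0; lra.
  have j0 : 0 < (k + 1 + 2)^-1 by rewrite invr_gt0; lra.
  have ik : (k + 2)^-1 * (k + 2) = 1 by apply: mulVf; lra.
  have s0 : 0 <= s <= 1 by rewrite /s; nra.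
  have : s - s ^+ 2 / 2 <= 2 * (k + 1 + 2)^-1.
    rewrite -subr_ge0.
    have -> : 2 * (k + 1 + 2)^-1 - (s - s ^+ 2 / 2) = 2 * ((k + 1 + 2)^-1 * (k + 2)^-1 ^+ 2).
      by rewrite /s; field; lra.
    by rewrite !mulr_ge0 ?exprn_ge0 ?ltW.
  move: IH; rewrite -/s; nra.
have h2 : 2 * harmonic n @[n --> \oo] --> (0 : R).
  by rewrite -[X in _ --> X](mulr0 (2 : R)); apply: cvgMr; exact: cvg_harmonic.
have near_h : \forall n \near \oo, 0 <= 1 - sqrt_maj n <= 2 * harmonic n.
  near=> n; rewrite sqrt_maj_le1 (le_trans (h n)) // ler_wpM2l //=.
  by rewrite lef_pV2 ?posrE // -?[n.+1%:R]natr1; lra.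
apply: (squeeze_cvgr near_h _ h2); exact: cvg_cst.
Unshelve. all: by end_near.
Qed.

End SqrtMajorant.

Section SquareRoot.
Context (R : realType) (A : comCStarAlgType R).
Implicit Types a b x y p q w : A.

(** The increments of the iteration factor as half of [(u n.+1 + u n) * (u n.+1 - u n)], so those of
    [sqrt_maj] dominate them. This covers the boundary case of norm 1, which a geometric rate would
    exclude. *)
Lemma ex_sqrt x : star x = x -> nrm x <= 1 ->
  exists y, [/\ star y = y, nrm y <= 1 & 1 - x = (1 - y) ^+ 2].
Proof.
move=> xs x1; have x0 := nrm_ge0 x.
pose u := fix u n : A := if n is m.+1 then rho (1 / 2) * (x + u m ^+ 2) else 0.
pose t := @sqrt_maj R; pose e n : R := 1 - t n.
have h0 : 0 <= 1 / 2 :> R by lra.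
have half2 : rho (1 / 2) + rho (1 / 2) = 1 :> A.
  by rewrite -rmorphD -(rmorph1 (@rho R A)); congr rho; lra.
have nh y : nrm (rho (1 / 2) * y) <= nrm y / 2.
  have := nrmM (rho (1 / 2)) y; have := nrm_rho A h0; have := nrm_ge0 y; nra.
have uS n : u n.+1 = rho (1 / 2) * (x + u n ^+ 2) by [].
have tS n : t n.+1 = (1 + t n ^+ 2) / 2 by [].
have ut n : nrm (u n) <= t n.
  elim: n => [|n IH]; first by rewrite /= /nrm normr0.
  have := nh (x + u n ^+ 2); have := nrmD x (u n ^+ 2); have := nrmM (u n) (u n).
  have := nrm_ge0 (u n); rewrite /= -/t expr2; nra.
have us n : star (u n) = u n.
  by elim: n => [|n IH]; rewrite /= ?star0 // expr2 !(starMC, starD) star_rho xs IH.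
have ue n : nrm (u n.+1 - u n) <= e n - e n.+1.
  elim: n => [|n IH].
    rewrite /e /t /= expr0n /= subr0 addr0; have := nh x; lra.
  have -> : u n.+2 - u n.+1 = rho (1 / 2) * ((u n.+1 + u n) * (u n.+1 - u n)).
    rewrite (uS n.+1); have := uS n; set v := u n.+1 => vE; rewrite {2}vE; ring.
  have := nh ((u n.+1 + u n) * (u n.+1 - u n)).
  have := nrmM (u n.+1 + u n) (u n.+1 - u n).
  have := nrmD (u n.+1) (u n); have := ut n; have := ut n.+1.
  have := nrm_ge0 (u n.+1 + u n); have := nrm_ge0 (u n.+1 - u n).
  have -> : e n.+1 - e n.+2 = (t n.+1 + t n) * (t n.+1 - t n) / 2.
    rewrite /e (tS n.+1); have := tS n; set v := t n.+1 => vE; rewrite {1}vE; lra.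
  move: IH; rewrite /e; nra.
have e0 := @sqrt_maj_cvg R.
have [l lu] := nrm_complete (@sqrt_maj_le1 R) e0 ue.
have l1 : nrm l <= 1.
  have := nrmD (l - u 0) (u 0); rewrite subrK; have := lu 0; have := ut 0; rewrite /t; lra.
exists l; split=> //.
- apply/eqP; rewrite -subr_eq0; apply/eqP/nrm_eq0/eqP.
  rewrite eq_le nrm_ge0 andbT; apply: (le0_of_cvg0 (K := 2) e0) => n.
  have -> : star l - l = star (l - u n) - (l - u n) by rewrite starB us; ring.
  by have := nrmD (star (l - u n)) (- (l - u n)); rewrite nrmN nrm_star; have := lu n; lra.
- apply/eqP; rewrite -subr_eq0; apply/eqP/nrm_eq0/eqP.
  (* Since [l + u n] has norm at most 2, the defect is at most [2 * e n.+1 + 2 * e n <= 4 * e n]. *)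
  rewrite eq_le nrm_ge0 andbT; apply: (le0_of_cvg0 (K := 4) e0) => n.
  have -> : 1 - x - (1 - l) ^+ 2 = (l - u n.+1) *+ 2 - (l + u n) * (l - u n).
    transitivity (l *+ 2 - l ^+ 2 + u n ^+ 2 - (rho (1 / 2) + rho (1 / 2)) * (x + u n ^+ 2)).
      by rewrite half2; ring.
    by rewrite /=; ring.
  have := nrmD ((l - u n.+1) *+ 2) (- ((l + u n) * (l - u n))); rewrite nrmN mulr2n.
  have := nrmD (l - u n.+1) (l - u n.+1); have := lu n; have := lu n.+1.
  have := ue n; rewrite /e /t; have := nrm_ge0 (u n.+1 - u n).
  have := nrmM (l + u n) (l - u n); have := nrm_ge0 (l - u n).
  have : nrm (l + u n) <= 2.
    by have := nrmD l (u n); have := ut n; have := sqrt_maj_le1 R n; rewrite /t; lra.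
  have := nrm_ge0 (l + u n); nra.
Qed.

End SquareRoot.

(** * The cone of positive elements *)

Section PositiveCone.
Context (R : realType) (A : comCStarAlgType R).
Implicit Types e f g h p q u v w x y : A.

Lemma nrm_rhoM r x : 0 <= r -> nrm (rho r * x) = r * nrm x.
Proof. by move=> r0; rewrite -scale_rho nrmZr. Qed.

Lemma starZ_i x : star ('i%C *: x) = - ('i%C *: star x).
Proof.
by rewrite starZ -scaleNr; congr (_ *: _); apply/eqP; rewrite eq_complex /= oppr0 !eqxx.
Qed.

Lemma sqrZ_i x : ('i%C *: x) ^+ 2 = - x ^+ 2.
Proof.
rewrite expr2 [LHS]cmulZl [X in _ *: X]cmulZr scalerA -expr2 sqr_i scaleN1r.
by rewrite expr2.
Qed.

Lemma nrm_sqr x : star x = x -> nrm (x ^+ 2) = nrm x ^+ 2.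
Proof. by move=> xs; rewrite -nrm_starM xs expr2. Qed.

(* C*-identity for [z = x + i y], and [2 x = z + z^*]. *)
Lemma nrm_sqr_le x y : star x = x -> star y = y ->
  nrm x ^+ 2 <= nrm (x ^+ 2 + y ^+ 2).
Proof.
move=> xs ys; pose v : A := 'i%C *: y.
have vs : star v = - v by rewrite starZ_i ys.
have vv : v ^+ 2 = - y ^+ 2 by exact: sqrZ_i.
pose z := x + v.
have zs : star z = x - v by rewrite starD xs vs.
have zz : nrm z ^+ 2 = nrm (x ^+ 2 + y ^+ 2).
  rewrite -nrm_starM zs; congr nrm; rewrite -[y ^+ 2]opprK -vv /z; ring.
have : rho 2 * x = z + star z.
  by rewrite zs (_ : 2 = 1 + 1) // rmorphD rmorph1 /z; ring.
move=> /(congr1 (@nrm _ _)); rewrite nrm_rhoM // => h.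
have := nrmD z (star z); rewrite -h nrm_star -zz.
have := nrm_ge0 x; have := nrm_ge0 z; nra.
Qed.

Definition pos x := exists2 y, star y = y & x = y ^+ 2.

Lemma pos_sa p : pos p -> star p = p.
Proof. by move=> [y ys ->]; rewrite expr2 starMC ys. Qed.

Lemma pos_sqr x : star x = x -> pos (x ^+ 2).
Proof. by exists x. Qed.

Lemma posM p q : pos p -> pos q -> pos (p * q).
Proof.
move=> [x xs ->] [y ys ->]; exists (x * y); first by rewrite starMC xs ys.
by rewrite exprMn.
Qed.

Lemma pos_rho r : 0 <= r -> pos (rho r).
Proof.
move=> r0; exists (rho (Num.sqrt r)); first exact: star_rho.
by rewrite -rmorphXn sqr_sqrtr.
Qed.

Lemma nrm_pos_le p q : pos p -> pos q -> nrm p <= nrm (p + q).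
Proof.
by move=> [x xs ->] [y ys ->]; rewrite nrm_sqr //; exact: nrm_sqr_le.
Qed.

(** For [C > 0], [rho C - x] is [C] times [1 - x / C], and [ex_sqrt] makes the last factor a
    square. *)
Lemma pos_shift x C : star x = x -> nrm x <= C -> pos (rho C - x).
Proof.
move=> xs xC; have x0 := nrm_ge0 x.
have [C0|C0] := eqVneq C 0.
  have -> : x = 0 by apply: nrm_eq0; lra.
  by rewrite subr0; apply: pos_rho; lra.
have C1 : 0 < C by lra.
have V0 : 0 <= C^-1 by rewrite invr_ge0; lra.
have CV : rho C * rho C^-1 = 1 :> A by rewrite -rmorphM divff ?rmorph1.
have [||y [ys _ yE]] := @ex_sqrt _ _ (rho C^-1 * x).
- by rewrite starMC star_rho xs.
- by rewrite nrm_rhoM // mulrC ler_pdivrMr // mul1r.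
have -> : rho C - x = rho C * (1 - rho C^-1 * x).
  by rewrite mulrBr mulrA CV; ring.
rewrite yE; apply: posM; first by apply: pos_rho; lra.
by apply: pos_sqr; rewrite starB star1 ys.
Qed.

(** Both [rho C - p] and [p] are positive, and a positive summand has norm at most that of the sum,
    here [rho C]. *)
Lemma nrm_shift p C : pos p -> nrm p <= C -> nrm (rho C - p) <= C.
Proof.
move=> pp pC; have C0 : 0 <= C := le_trans (nrm_ge0 p) pC.
apply: le_trans (nrm_pos_le (pos_shift (pos_sa pp) pC) pp) _.
by rewrite subrK nrm_rho.
Qed.

(** Together with [nrm_shift] this tests positivity by a norm inequality, from which stability under
    sums and limits follows. *)
Lemma pos_of_shift p C : star p = p -> nrm (rho C - p) <= C -> pos p.
Proof.
move=> ps pC; have -> : p = rho C - (rho C - p) by ring.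
by apply: pos_shift; rewrite ?starB ?star_rho ?ps.
Qed.

Lemma posD p q : pos p -> pos q -> pos (p + q).
Proof.
move=> pp pq; have p0 := nrm_ge0 p; have q0 := nrm_ge0 q.
apply: (@pos_of_shift _ (nrm p + nrm q)); first by rewrite starD !pos_sa.
have -> : rho (nrm p + nrm q) - (p + q) = (rho (nrm p) - p) + (rho (nrm q) - q).
  by rewrite rmorphD; ring.
apply: le_trans (nrmD _ _) _; apply: lerD; exact: nrm_shift.
Qed.

Lemma pos_closed p : star p = p ->
  (forall r, 0 < r -> pos (p + rho r)) -> pos p.
Proof.
move=> ps pr; apply: (@pos_of_shift _ (nrm p + 1)) => //.
have p0 := nrm_ge0 p.
apply/ler_addgt0Pl => r r0.
(* [s <= 1] keeps the norm of [p + rho s] below [nrm p + 1]; [s <= r] keeps the loss in the triangle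
   inequality below [r]. *)
pose s := Num.min r 1.
have s0 : 0 < s by rewrite lt_min r0 ltr01.
have [sr s1] : s <= r /\ s <= 1 by rewrite /s !ge_min !lexx orbT.
have := @nrm_shift (p + rho s) (nrm p + 1) (pr _ s0).
have := nrmD p (rho s); have := nrm_rho A (ltW s0).
have := nrmD (rho (nrm p + 1) - (p + rho s)) (rho s).
have -> : rho (nrm p + 1) - (p + rho s) + rho s = rho (nrm p + 1) - p by ring.
set u := nrm _; set v := nrm _; set t := nrm _; set z := nrm _.
move=> H1 H2 H3 H4; have := H4 ltac:(lra); lra.
Qed.

(** The gain over [pos] is a positive root: after rescaling, [ex_sqrt] gives a root [1 - y] with
    [nrm y <= 1], and [pos_shift] applies to it. *)
Lemma ex_pos_sqrt p : pos p -> exists2 s, pos s & p = s ^+ 2.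
Proof.
move=> pp; pose C := nrm p + 1; have p0 := nrm_ge0 p.
have C0 : 0 < C by rewrite /C; lra.
have V0 : 0 <= C^-1 by rewrite invr_ge0 ltW.
have CV : rho C * rho C^-1 = 1 :> A by rewrite -rmorphM divff ?rmorph1 // gt_eqF.
have pV : pos (rho C^-1 * p) by apply: posM => //; exact: pos_rho.
have nV : nrm (rho C^-1 * p) <= 1.
  by rewrite nrm_rhoM // mulrC ler_pdivrMr // mul1r /C; lra.
have [||y [ys y1 yE]] := @ex_sqrt _ _ (1 - rho C^-1 * p).
- by rewrite starB star1 pos_sa.
- by rewrite -(rmorph1 (@rho R A)); exact: nrm_shift.
exists (rho (Num.sqrt C) * (1 - y)).
  apply: posM; first by apply: pos_rho; rewrite sqrtr_ge0.
  by rewrite -(rmorph1 (@rho R A)); exact: pos_shift.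
rewrite exprMn -rmorphXn sqr_sqrtr ?ltW //= -yE.
by rewrite opprB addrC subrK mulrA CV mul1r.
Qed.

Lemma sa_inv q j : star q = q -> q * j = 1 -> star j = j.
Proof.
move=> qs qj; have := congr1 (@star _ _) qj; rewrite starMC qs star1 => qj'.
by rewrite -[LHS]mul1r -qj -[RHS]mulr1 -[in RHS]qj'; ring.
Qed.

Lemma pos_inv q j : pos q -> q * j = 1 -> pos j.
Proof.
move=> pq qj; have js := sa_inv (pos_sa pq) qj.
have -> : j = q * j ^+ 2 by rewrite expr2 mulrA qj mul1r.
by apply: posM => //; exact: pos_sqr.
Qed.

(** With [C = nrm p + r], [rho r + p] is [C] times [1 - x] where [x = (nrm p - p) / C] has norm
    below 1, so the Neumann series inverts it. *)
Lemma pos_unit p r : pos p -> 0 < r ->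
  exists2 j, pos j & (rho r + p) * j = 1.
Proof.
move=> pp r0; have p0 := nrm_ge0 p; pose C := nrm p + r.
have C0 : 0 < C by rewrite /C; lra.
have V0 : 0 < C^-1 by rewrite invr_gt0.
have VC : C^-1 * C = 1 by rewrite mulVf // gt_eqF.
have CV : rho C * rho C^-1 = 1 :> A by rewrite -rmorphM mulrC VC rmorph1.
pose x := rho C^-1 * (rho (nrm p) - p).
have xn : nrm x <= C^-1 * nrm p.
  rewrite nrm_rhoM ?(ltW V0) // ler_pM2l //; exact: nrm_shift.
have x1 : C^-1 * nrm p < 1 by rewrite -VC ltr_pM2l // /C; lra.
have [y xy] := neumann xn x1.
have E : (rho r + p) * (rho C^-1 * y) = 1.
  have -> : rho r + p = rho C * (1 - x).
    rewrite mulrBr /x mulrA CV mul1r /C rmorphD; ring.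
  have -> : rho C * (1 - x) * (rho C^-1 * y) = (rho C * rho C^-1) * ((1 - x) * y) by ring.
  by rewrite CV xy mulr1.
exists (rho C^-1 * y) => //; apply: pos_inv E.
by apply: posD => //; apply: pos_rho; exact: ltW.
Qed.

(* [u * (u + v) = u ^+ 2 + u * v], and [u + v >= r] is invertible. *)
Lemma pos_of_mul_sum u v r : star u = u -> pos (u * v) ->
  0 < r -> pos (u + v - rho r) -> pos u.
Proof.
move=> us puv r0 pp; have [j pj] := pos_unit pp r0.
rewrite addrC subrK => E.
have -> : u = (u ^+ 2 + u * v) * j.
  by rewrite -[LHS]mulr1 -E; ring.
by apply: posM => //; apply: posD => //; exact: pos_sqr.
Qed.

(** [y] is the positive root of [w ^+ 2], the absolute value of [w]. For [z] equal to [w] or [- w],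
    [y + z + r] and [y - z + r] have a positive product and a sum at least [r]; [pos_of_mul_sum]
    applies, and [r] tends to 0. *)
Lemma ex_abs w : star w = w ->
  exists y, [/\ pos y, y ^+ 2 = w ^+ 2, pos (y + w) & pos (y - w)].
Proof.
have H y z : pos y -> star z = z -> y ^+ 2 = z ^+ 2 -> pos (y + z).
  move=> py zs yz; apply: pos_closed; first by rewrite starD zs pos_sa.
  move=> r r0; apply: (@pos_of_mul_sum _ (y + rho r - z) r).
  - by rewrite !starD star_rho zs pos_sa.
  - have -> : (y + z + rho r) * (y + rho r - z) =
        rho r * (y + y) + rho r ^+ 2 + (y ^+ 2 - z ^+ 2) by ring.
    rewrite yz subrr addr0; apply: posD; last exact/pos_sqr/star_rho.
    by apply: posM; [apply/pos_rho/ltW|exact: posD].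
  - by [].
  - have -> : y + z + rho r + (y + rho r - z) - rho r = y + y + rho r by ring.
    by apply: posD; [exact: posD|apply/pos_rho/ltW].
move=> ws; have [y py yE] := ex_pos_sqrt (pos_sqr ws).
exists y; split=> //; first exact: H.
by apply: H => //; rewrite ?starN ?ws // sqrrN.
Qed.

Lemma double_inj x y : x + x = y + y -> x = y.
Proof.
have H z : z = rho (1 / 2) * (z + z).
  rewrite mulrDr -mulrDl -rmorphD (_ : 1 / 2 + 1 / 2 = 1); last by lra.
  by rewrite rmorph1 mul1r.
by move=> xy; rewrite [x]H xy -H.
Qed.

(** By commutativity, [star x * x] is the sum of the squares of the real and imaginary parts of
    [x]. *)
Lemma pos_starM x : pos (star x * x).
Proof.
pose v : A := 'i%C *: (star x - x).
have E : star x * x = rho (1 / 2) ^+ 2 * ((star x + x) ^+ 2 + v ^+ 2).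
  rewrite sqrZ_i; have -> : (star x + x) ^+ 2 - (star x - x) ^+ 2 = rho 4 * (star x * x).
    by rewrite (_ : 4 = 1 + 1 + 1 + 1) ?rmorphD ?rmorph1; [ring|lra].
  rewrite mulrA -rmorphXn -rmorphM (_ : (1 / 2) ^+ 2 * 4 = 1); last by lra.
  by rewrite rmorph1 mul1r.
rewrite E; apply: posM; first exact/pos_sqr/star_rho.
apply: posD; apply: pos_sqr; first by rewrite starD starK addrC.
by rewrite starZ_i starB starK -scalerN opprB.
Qed.

(** Parallelogram law for [e * g] and [f * h], with [k] bounding both [star g * g] and [star h * h];
    the added 1 makes [k] positive. *)
Lemma pos_starM_sub f e g h : star f = f -> star e = e ->
  exists2 k, 0 < k & pos (rho k * (f ^+ 2 + e ^+ 2) -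
     star (e * g - f * h) * (e * g - f * h)).
Proof.
move=> sf se; pose k := nrm (star g * g) + nrm (star h * h) + 1.
have g0 := nrm_ge0 (star g * g); have h0 := nrm_ge0 (star h * h).
have kP x : nrm (star x * x) <= k -> pos (rho k - star x * x).
  by apply: pos_shift; exact/pos_sa/pos_starM.
have kg := kP g ltac:(rewrite /k; lra); have kh := kP h ltac:(rewrite /k; lra).
exists (2 * k); first by rewrite /k; lra.
have -> : rho (2 * k) * (f ^+ 2 + e ^+ 2) - star (e * g - f * h) * (e * g - f * h) =
    star (e * g + f * h) * (e * g + f * h) +
    rho 2 * (e ^+ 2 * (rho k - star g * g) + f ^+ 2 * (rho k - star h * h)).
  rewrite !(starB, starD, starMC) sf se (_ : 2 = 1 + 1) // rmorphM rmorphD rmorph1.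
  ring.
apply: posD; first exact: pos_starM.
apply: posM; first exact: pos_rho.
by apply: posD; apply: posM => //; exact: pos_sqr.
Qed.

End PositiveCone.

(** * The preordering generated by one element *)

Section Precone.
Context (R : realType) (A : comCStarAlgType R).
Implicit Types a b x y p q w e : A.

(** Two terms suffice for stability under products: [e ^+ 2] is positive when [e] is self-adjoint,
    so it is absorbed into [p]. *)
Definition precone e x := exists p q, [/\ pos p, pos q & x = p + q * e].

Lemma pos0 : pos (0 : A).
Proof. by exists 0; rewrite ?star0 ?expr0n. Qed.

Lemma precone_pos e p : pos p -> precone e p.
Proof. by move=> pp; exists p, 0; split=> //; [exact: pos0|rewrite mul0r addr0]. Qed.

Lemma precone_gen e : precone e e.
Proof.
exists 0, 1; split; rewrite ?mul1r ?add0r //; first exact: pos0.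
by rewrite -(rmorph1 (@rho R A)); exact: pos_rho.
Qed.

Lemma preconeD e x y : precone e x -> precone e y -> precone e (x + y).
Proof.
move=> [p [q [pp pq ->]]] [s [t [ps pt ->]]]; exists (p + s), (q + t).
by split; [exact: posD|exact: posD|ring].
Qed.

Lemma preconeM e x y : star e = e ->
  precone e x -> precone e y -> precone e (x * y).
Proof.
move=> es [p [q [pp pq ->]]] [s [t [ps pt ->]]].
exists (p * s + q * t * e ^+ 2), (p * t + q * s); split; last by ring.
- by apply: posD; apply: posM => //; [exact: posM|exact: pos_sqr].
- by apply: posD; exact: posM.
Qed.

Lemma preconeZ e x r : star e = e -> 0 <= r -> precone e x -> precone e (rho r * x).
Proof. by move=> es r0; apply: preconeM => //; apply/precone_pos/pos_rho. Qed.

(** From [-1 = p + q * (b - r)] comes [q * (r - b) = 1 + p]. The right side has a positive inverse,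
    so [r - b] is positive, and [b] is a positive summand of [r]. *)
Lemma nrm_of_precone (b : A) r : pos b -> 0 < r ->
  precone (b - rho r) (-1) -> nrm b <= r.
Proof.
move=> pb r0 [p [q [pp pq E]]].
have [j pj] := pos_unit pp (@ltr01 R); rewrite rmorph1 => Ej.
have qE : q * (rho r - b) = 1 + p.
  by rewrite -[1]opprK E; ring.
have pe : pos (rho r - b).
  have K : q * ((rho r - b) * j) = 1 by rewrite mulrA qE.
  have pi : pos ((rho r - b) * j) := pos_inv pq K.
  have -> : rho r - b = (1 + p) * ((rho r - b) * j).
    by rewrite mulrCA Ej mulr1.
  apply: posM => //; apply: posD => //.
  by rewrite -(rmorph1 (@rho R A)); exact: pos_rho.
have := nrm_pos_le pb pe; rewrite addrC subrK => h.
exact: le_trans h (nrm_rho _ (ltW r0)).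
Qed.

(** Seen on points, the infimum of [T] would be the maximum of [a] over the set where [e >= 0]. It
    would be attained if that set were nonempty, while the hypothesis keeps [(l - a) ^+ 2] away from
    0 there. *)
Lemma precone_spectrum a e : star a = a -> star e = e ->
  (forall l, exists2 r, 0 < r & precone e ((rho l - a) ^+ 2 - rho r)) ->
  precone e (-1).
Proof.
move=> sa se H; pose T := [set t : R | precone e (rho t - a)].
have [//|nQ] := pselect (precone e (-1)).
have T0 : T (nrm a) by apply/precone_pos/pos_shift.
(* Only here does it matter that [-1] is outside the preordering: otherwise [T] could be unbounded
   below. *)
have Tlb t : T t -> - nrm a - 1 <= t.
  move=> Tt; rewrite leNgt; apply/negP => tl; apply: nQ.
  have -> : -1 = (rho t - a) + (rho (- t - 1) - (- a)) :> A.
    by rewrite rmorphB rmorphN rmorph1; ring.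
  apply: preconeD => //; apply/precone_pos/pos_shift; first by rewrite starN sa.
  by rewrite nrmN; lra.
have Tinf : has_inf T by split; [exists (nrm a)|exists (- nrm a - 1)].
pose t0 := inf T.
have Tup t : 0 < t -> T (t0 + t).
  move=> tp; have [s Ts st] := inf_adherent tp Tinf.
  rewrite /T /=; have -> : rho (t0 + t) - a = (rho s - a) + rho (t0 + t - s).
    by rewrite !(rmorphD, rmorphB); ring.
  by apply: preconeD => //; apply/precone_pos/pos_rho; rewrite subr_ge0 ltW.
have [d d0 Hd] := H t0; pose w := rho t0 - a; rewrite -/w in Hd.
have ws : star w = w by rewrite starB star_rho sa.
pose c := nrm w + 1; have c0 : 0 < c by rewrite /c; have := nrm_ge0 w; lra.
(* The first bound keeps [c - h] positive, the second keeps [d - h * c] at least [d / 2]. *)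
pose h := Num.min (c / 2) (d / (2 * c)).
have h0 : 0 < h by rewrite lt_min !divr_gt0 ?mulr_gt0.
have [hc hd] : h <= c / 2 /\ h * c <= d / 2.
  split; first by rewrite /h ge_min lexx.
  have : h <= d / (2 * c) by rewrite /h ge_min lexx orbT.
  by rewrite ler_pdivlMr ?mulr_gt0 //; clear -d; lra.
have Qh : precone e (w + rho h).
  have -> : w + rho h = rho (t0 + h) - a by rewrite /w rmorphD; ring.
  exact: Tup.
have Qc : precone e (rho c - w).
  by apply/precone_pos/pos_shift => //; rewrite /c lerDl.
(* Modulo [Q], [0 <= w <= c] and [w ^+ 2 >= d] give [c * w >= w ^+ 2 >= d]; the
   slack [h] is there because only [w + h], not [w], is known to be in [Q]. *)
pose k := (d - h * c) / (c - h).
have ch0 : 0 < c - h by lra.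
have k0 : 0 < k by rewrite divr_gt0 //; lra.
have kE : k * (c - h) = d - h * c by rewrite mulfVK // gt_eqF.
clearbody k.
(* The squares cancel in [(w + h) * (c - w) + (w ^+ 2 - d)], which leaves [(c - h) * (w - k)]. *)
have Qk : precone e (w - rho k).
  have -> : w - rho k =
      rho (c - h)^-1 * ((w + rho h) * (rho c - w) + (w ^+ 2 - rho d)).
    have V : rho (c - h)^-1 * (rho c - rho h) = 1 :> A.
      by rewrite -rmorphB -rmorphM mulVf ?rmorph1 // gt_eqF.
    have -> : (w + rho h) * (rho c - w) + (w ^+ 2 - rho d) =
        (rho c - rho h) * w - rho (k * (c - h)).
      by rewrite kE !(rmorphB, rmorphM); ring.
    rewrite rmorphM rmorphB -[LHS]mul1r -V; ring.
  apply: preconeZ => //; first by rewrite invr_ge0 ltW.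
  by apply: preconeD => //; exact: preconeM.
have : T (t0 - k).
  rewrite /T /=; have -> : rho (t0 - k) - a = w - rho k by rewrite rmorphB /w; ring.
  by [].
move=> /(ge_inf (proj2 Tinf)); rewrite -/t0; lra.
Qed.

End Precone.

(** * Vanishing of derivations of a commutative C*-algebra *)

Section Derivations.
Context (R : realType) (A : comCStarAlgType R) (D : A -> A).
Context (D_lin : linear D).
Context (DM : forall x y, D (x * y) = D x * y + x * D y).

Lemma derD x y : D (x + y) = D x + D y.
Proof. by have := D_lin 1 x y; rewrite !scale1r. Qed.

Lemma der0 : D 0 = 0.
Proof. by apply: (@addrI _ (D 0)); rewrite -derD !addr0. Qed.

Lemma derZ k x : D (k *: x) = k *: D x.
Proof. by have := D_lin k x 0; rewrite der0 !addr0. Qed.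

Lemma derB x y : D (x - y) = D x - D y.
Proof. by rewrite derD -scaleN1r derZ scaleN1r. Qed.

Lemma der_rho r : D (rho r) = 0.
Proof.
suff D1 : D 1 = 0 by rewrite derZ D1 scaler0.
by apply: (@addrI _ (D 1)); have := DM 1 1; rewrite !mulr1 mul1r addr0 => <-.
Qed.

Lemma der_sa_eq0 a : star a = a -> D a = 0.
Proof.
move=> sa; apply: contrapT => Da0; pose b := D a; pose B := star b * b.
have b0 : 0 < nrm b.
  by rewrite lt_neqAle nrm_ge0 andbT; apply/eqP => /esym/nrm_eq0.
have B0 : 0 < nrm B by rewrite nrm_starM exprn_gt0.
have pB : pos B by exact: pos_starM.
pose r := nrm B / 2; have r0 : 0 < r by rewrite /r; lra.
suff /(nrm_of_precone pB r0) : precone (B - rho r) (-1) by rewrite /r; lra.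
set e := B - rho r; have se : star e = e by rewrite starB star_rho pos_sa.
apply: (@precone_spectrum _ _ a) => // l.
pose w := rho l - a; rewrite -/w; have sw : star w = w by rewrite starB star_rho sa.
have [y [py yE [u su uE] [v sv vE]]] := ex_abs sw.
have [K K0 HK] := @pos_starM_sub _ _ u v (D v) (D u) su sv.
(* Differentiate [2 w = u ^+ 2 - v ^+ 2], where [D w = - b]. *)
have bE : b = v * D v - u * D u.
  have Dw : D w = - b by rewrite derB der_rho sub0r.
  have : D (u ^+ 2 - v ^+ 2) = D (w + w) by congr D; rewrite -uE -vE; ring.
  rewrite derB derD !expr2 !DM Dw => h.
  apply: double_inj; transitivity (- (- b - b)); first by ring.
  by rewrite -h; ring.
rewrite -bE -/B in HK.
(* As [u ^+ 2 + v ^+ 2 = 2 y], [HK] says [B <= 2 K y]; where [B >= r] this gives [y >= s], hence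
   [w ^+ 2 = y ^+ 2 >= s ^+ 2]. *)
pose s := r / (2 * K); have s0 : 0 < s by rewrite divr_gt0 ?mulr_gt0.
exists (s ^+ 2); first exact: exprn_gt0.
have Qs : precone e (y - rho s).
  have -> : y - rho s = rho (2 * K)^-1 * ((rho K * (u ^+ 2 + v ^+ 2) - B) + e).
    have -> : u ^+ 2 + v ^+ 2 = rho 2 * y.
      by rewrite -uE -vE -[2]/(1 + 1) rmorphD rmorph1; ring.
    have V : rho (2 * K)^-1 * (rho 2 * rho K) = 1 :> A.
      by rewrite -!rmorphM mulVf ?rmorph1 // gt_eqF // mulr_gt0.
    rewrite /e /s mulrC rmorphM -[y in LHS]mul1r -V; ring.
  apply: preconeZ => //; first by rewrite invr_ge0 mulr_ge0 ?ltW.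
  by apply: preconeD; [exact: precone_pos|exact: precone_gen].
have -> : w ^+ 2 - rho (s ^+ 2) = (y - rho s) * (y + rho s).
  by rewrite -yE rmorphXn; ring.
apply: preconeM => //; apply/precone_pos/posD => //; exact/pos_rho/ltW.
Qed.

Lemma der_eq0 a : D a = 0.
Proof.
have D1 : D (a + star a) = 0 by apply: der_sa_eq0; rewrite starD starK addrC.
have D2 : D ('i%C *: (star a - a)) = 0.
  by apply: der_sa_eq0; rewrite starZ_i starB starK -scalerN opprB.
apply: double_inj; rewrite addr0.
have -> : D a + D a = D (a + star a) - D (star a - a) by rewrite derD derB; ring.
rewrite D1 sub0r; apply/eqP; rewrite oppr_eq0; apply/eqP.
have := congr1 (fun z => (- 'i%C) *: z) D2.
by rewrite scaler0 -derZ scalerA mulNr -expr2 sqr_i opprK scale1r.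
Qed.

End Derivations.

(** * Inner product bounds, fullness and central operators *)

Section Module.
Context (R : realType) (A : comCStarAlgType R) (M : hilbertModType A).
Implicit Types (a b : A) (x y z : M).

Lemma innerDl x y z : inner (x + y) z = inner x z + inner y z.
Proof. by have := inner_linear 1 x y z; rewrite !scale1r. Qed.

Lemma inner0l z : inner (0 : M) z = 0.
Proof. by apply: (@addrI _ (inner 0 z)); rewrite -innerDl !addr0. Qed.

Lemma innerZl (k : R[i]) x z : inner (k *: x) z = k *: inner x z.
Proof. by have := inner_linear k x 0 z; rewrite inner0l !addr0. Qed.

Lemma innerDr x y z : inner x (y + z) = inner x y + inner x z.
Proof. by rewrite inner_star innerDl starD -!inner_star. Qed.

Lemma innerZr (k : R[i]) x y : inner x (k *: y) = k^* *: inner x y.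
Proof. by rewrite inner_star innerZl starZ -inner_star. Qed.

Lemma nrm_inner x : nrm (inner x x) = nrm x ^+ 2.
Proof.
apply: (@complexI R); rewrite rmorphXn /= -!normE.
by rewrite [in RHS](@hnormE _ _ _ x) sqrtCK.
Qed.

Lemma nrm_innerD_le x y :
  nrm (inner x y + inner y x) <= (nrm x + nrm y) ^+ 2.
Proof.
have x0 := nrm_ge0 x; have y0 := nrm_ge0 y.
have E : rho 2 * (inner x y + inner y x) =
    inner (x + y) (x + y) - inner (x - y) (x - y).
  rewrite -[- y]scaleN1r !innerDl !innerDr !innerZl !innerZr rmorphN rmorph1.
  rewrite !scaleN1r (_ : 2 = 1 + 1) // rmorphD rmorph1; ring.
have := congr1 (@nrm _ _) E; rewrite nrm_rhoM //.
have := nrmD (inner (x + y) (x + y)) (- inner (x - y) (x - y)).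
rewrite nrmN !nrm_inner.
have := nrmD x y; have := nrmD x (- y); rewrite nrmN.
have := nrm_ge0 (x + y); have := nrm_ge0 (x - y); nra.
Qed.

(* By polarization, as the Cauchy-Schwarz inequality would need that spectrally
   positive elements are squares. *)
Lemma nrm_inner_le_sqr x y : nrm (inner x y) <= (nrm x + nrm y) ^+ 2.
Proof.
have ci : ('i%C : R[i])^* = - 'i%C.
  by apply/eqP; rewrite eq_complex /= oppr0 !eqxx.
have ni (V : normedModType R[i]) (v : V) : nrm ('i%C *: v) = nrm v.
  by rewrite nrmZ normc_def /= expr0n /= add0r expr1n sqrtr1 mul1r.
have := nrm_innerD_le x y; have := nrm_innerD_le x ('i%C *: y).
rewrite innerZl innerZr ci scaleNr addrC -scalerBr !ni nrmB.
have := nrmD (inner x y + inner y x) (inner x y - inner y x).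
have -> : inner x y + inner y x + (inner x y - inner y x) = rho 2 * inner x y.
  by rewrite (_ : 2 = 1 + 1) // rmorphD rmorph1; ring.
rewrite nrm_rhoM //; lra.
Qed.

(** Rescaling [x] to norm 1 turns the quadratic bound into one linear in [nrm x], which is what the
    boundedness of [theta] requires. *)
Lemma nrm_inner_le x y : nrm (inner x y) <= (1 + nrm y) ^+ 2 * nrm x.
Proof.
have [x0|x0] := eqVneq (nrm x) 0.
  by rewrite (nrm_eq0 x0) inner0l /nrm !normr0 mulr0.
have xp : 0 < nrm x by rewrite lt_neqAle eq_sym x0 nrm_ge0.
have V0 : 0 <= (nrm x)^-1 by rewrite invr_ge0 ltW.
have := nrm_inner_le_sqr (((nrm x)^-1)%:C%C *: x) y.
by rewrite innerZl !nrmZr // mulVf // mulrC ler_pdivrMr.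
Qed.

Lemma hact0l z : hact 0 z = 0.
Proof. by apply: (@addrI _ (hact 0 z)); rewrite -hactDl !addr0. Qed.

Lemma hact_sum n (c : 'I_n -> A) z :
  hact (\sum_i c i) z = \sum_i hact (c i) z.
Proof.
exact: (big_morph (fun a : A => hact a z) (fun a b => hactDl a b z) (hact0l z)).
Qed.

Lemma is_hend_theta x y : is_hend (fun z : M => hact (inner z y) x).
Proof.
apply/asboolP; split.
- by move=> k u v; rewrite inner_linear hactDl hactZl.
- by move=> a z; rewrite hactA inner_hact.
- exists (((1 + nrm y) ^+ 2 * nrm x)%:C)%C => z.
  apply: le_trans (norm_hact _ _) _.
  rewrite !normE -!rmorphM lecR /=.
  have := nrm_inner_le z y; have := nrm_ge0 x; have := nrm_ge0 z; nra.
Qed.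

Definition theta x y : hend M := Hend (is_hend_theta x y).

(** Some [u] in the span lies within 1/2 of [1], so the Neumann series inverts it; the coefficients
    of [u] are absorbed into the [x i]. *)
Lemma full_unit : full_module M -> exists n (x y : 'I_n -> M) v,
  v * (\sum_i inner (x i) (y i)) = 1.
Proof.
move=> Mf; have : closure (linear_span [set a : A | exists x y : M, a = inner x y]) 1.
  by rewrite Mf.
have h0 : (0 : R[i]) < (1/2)%:C%C by rewrite ltcR; lra.
move=> /(_ (ball (1 : A) (1/2)%:C%C) (nbhsx_ballx _ _ h0)) [u [[n [c [s [sP uE]]]] ub]].
have [x xP] := choice sP; have [y xyP] := choice xP.
have {}uE : u = \sum_i inner (c i *: x i) (y i).
  by rewrite uE; apply: eq_bigr => i _; rewrite innerZl -xyP.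
have nu : nrm (1 - u) <= 1/2.
  by move: ub; rewrite -ball_normE /ball_ /= normE ltcR => /ltW.
have [v uv] := neumann nu ltac:(lra).
exists n, (fun i => c i *: x i), y, v.
by rewrite -uE mulrC; have -> : u = 1 - (1 - u) by ring.
Qed.

(** Commuting with [theta z (y i)] and evaluating at [x i] gives [<x_i, y_i> C z = <C x_i, y_i> z];
    then sum over [i] and multiply by [v]. *)
Lemma central_scale n (x y : 'I_n -> M) v (C : hend M) :
  v * (\sum_i inner (x i) (y i)) = 1 -> (forall T : hend M, C * T = T * C) ->
  C = hend_scale (v * \sum_i inner (C (x i)) (y i)) 1.
Proof.
move=> vu CT; apply/val_inj/funext => z /=.
transitivity (hact (v * \sum_i inner (x i) (y i)) (C z)).
  by rewrite vu hact1.
rewrite -!hactA !hact_sum; congr hact; apply: eq_bigr => i _.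
have := congr1 (fun T : hend M => T (x i)) (CT (theta z (y i))).
by rewrite /= hend_hact.
Qed.

End Module.

(** * From derivations on endomorphisms to derivations of the algebra *)

Theorem lemma2p1 (R : realType) (A : comCStarAlgType R) (M : hilbertModType A)
    (d : hend M -> hend M) (M_full : full_module M) (d_der : is_derivation d)
    (a : A) (T : hend M) :
  d (hend_scale a T) = hend_scale a (d T).
Proof.
have [d_lin dM] := d_der.
have [n [x [y [v vu]]]] := full_unit M_full.
pose phi (C : hend M) : A := v * \sum_i inner (C (x i)) (y i).
pose I (b : A) : hend M := hend_scale b 1.
have IM b S : I b * S = hend_scale b S by apply/val_inj/funext.
have MI b S : S * I b = hend_scale b S.
  by apply/val_inj/funext => z /=; rewrite hend_hact.
have phi_linear k S U : phi (k *: S + U) = k *: phi S + phi U.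
  have vZ w : v * (k *: w) = k *: (v * w) by exact: cmulZr.
  rewrite /phi -vZ -mulrDr scaler_sumr -big_split /=.
  by apply: (congr1 (cmul v)); apply: eq_bigr => i _; exact: inner_linear.
have phiI b S : phi (I b * S) = b * phi S.
  rewrite /phi mulrCA [X in _ = v * X]mulr_sumr; apply: (congr1 (cmul v)).
  by apply: eq_bigr => i _; exact: inner_hact.
(* Differentiating [I b * S = S * I b] and cancelling the terms in [d S], which agree as [I b] is
   central, shows that [d (I b)] is central. *)
have dI b : d (I b) = I (phi (d (I b))).
  apply: central_scale => // S.
  have := congr1 d (etrans (IM b S) (esym (MI b S))).
  rewrite !dM [I b * _]IM -[hend_scale b _]MI [RHS]addrC.
  by move/addIr.
(* By [phiI], [phi] is linear over [A], so [D] inherits the Leibniz rule from [d]. *)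
pose D b := phi (d (I b)).
have D0 : D a = 0.
  apply: der_eq0.
    move=> k b c; rewrite /D.
    have -> : I (k *: b + c) = k *: I b + I c.
      by apply/val_inj/funext => z /=; rewrite hactDl hactZl.
    by rewrite d_lin phi_linear.
  move=> b c; rewrite /D.
  have -> : I (b * c) = I b * I c.
    by apply/val_inj/funext => z /=; rewrite hactA.
  have := phi_linear 1 (d (I b) * I c) (I b * d (I c)); rewrite !scale1r -dM => ->.
  by rewrite MI -IM !phiI [c * _]mulrC.
rewrite -IM dM IM -[RHS]add0r; congr (_ + _).
rewrite dI -/(D a) D0; apply/val_inj/funext => z /=.
exact: hact0l.
Qed.
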